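(* Let $K$ and $G$ be groups, $e$ the identity of $G$, and $\varphi:K\to G$ a homomorphism. The Schreier extension $K\times_e^{\Theta}G$ defined by $$f(\tau,\sigma)=e,\quad\sigma,\tau\in K,\qquad\Theta_\sigma=\iota_{\varphi(\sigma)},\quad\sigma\in K,\qquad\iota_s(t)=sts^{-1},\quad s,t\in G,$$ is a right Bol loop. Moreover, the following conditions are equivalent: (i) $K\times_e^{\Theta}G$ is left nuclear; (ii) the image $\varphi(K')$ of the commutator subgroup $K'\subset K$ is contained in the centre of $G$; (iii) $K\times_e^{\Theta}G$ is a group.
   Context: A right Bol loop is a loop satisfying $z(xy\cdot x)=(zx\cdot y)x$. Let $\epsilon$ be the identity of $K$. For maps $f:K\times K\to G$ and $\Theta:K\to\mathrm{Aut}(G)$ with $f(\sigma,\epsilon)=f(\epsilon,\sigma)=e$ and $\Theta_\epsilon=\mathrm{Id}$, the Schreier extension $K\times_f^{\Theta}G$ is the loop on $K\times G$ with multiplication $(\sigma,s)(\tau,t)=(\sigma\tau,f(\sigma,\tau)\Theta_\tau(s)t)$; $K\times_e^{\Theta}G$ denotes the case of constant $f=e$. It is left nuclear if $\{\epsilon\}\times G$ is contained in the left nucleus $\{u: ux\cdot y=u\cdot xy\ \forall x,y\}$. *)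

(* Defs.v *)
From HB Require Import structures.
From mathcomp Require Import all_boot.

Set Implicit Arguments.
Unset Strict Implicit.
Unset Printing Implicit Defensive.

Local Open Scope group_scope.

(* [umagmaType] provides the multiplication and its two-sided identity 1;
   a loop is a [umagmaType] whose left and right divisions are uniquely
   solvable. *)
Definition is_loop (L : umagmaType) : Prop :=
  forall a b : L, (exists! x, a * x = b) /\ (exists! y, y * a = b).

Definition right_bol_identity (L : umagmaType) : Prop :=
  forall x y z : L, z * ((x * y) * x) = ((z * x) * y) * x.

Definition is_right_bol_loop (L : umagmaType) : Prop :=
  is_loop L /\ right_bol_identity L.

Definition left_nucleus (L : umagmaType) (u : L) : Prop :=
  forall x y : L, (u * x) * y = u * (x * y).

Definition is_group (L : umagmaType) : Prop :=
  associative (fun x y : L => x * y) /\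
  forall x : L, exists y : L, x * y = 1 /\ y * x = 1.

Definition is_subgroup (K : groupType) (H : K -> Prop) : Prop :=
  [/\ H 1, forall x y, H x -> H y -> H (x * y) & forall x, H x -> H x^-1].

Definition generated (K : groupType) (A : K -> Prop) (x : K) : Prop :=
  forall H : K -> Prop, is_subgroup H -> (forall a, A a -> H a) -> H x.

Definition commutator_subgroup (K : groupType) : K -> Prop :=
  generated (fun c : K => exists a b : K, c = [~ a, b]).

Definition centre (G : groupType) (z : G) : Prop :=
  forall x : G, commute z x.

Fact morph_one (K G : groupType) (f : {multiplicative K -> G}) : f 1 = 1.
Proof. by apply: (mulgI (f 1)); rewrite -gmulfM !mulg1. Qed.

Record automorphism (G : groupType) := Automorphism {
  aut_fun :> {multiplicative G -> G};
  aut_bij : bijective aut_fun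
}.

(* The data and the multiplication below make sense over any unital magma K;
   one gets a loop when K is a loop. *)
Record schreier_data (K : umagmaType) (G : groupType) := SchreierData {
  cocycle : K -> K -> G;
  twist : K -> automorphism G;
  cocycle_1r : forall sigma, cocycle sigma 1 = 1;
  cocycle_1l : forall sigma, cocycle 1 sigma = 1;
  twist_1 : forall t, twist 1 t = t
}.

(* An alias of K * G, to keep the multiplication below apart from the
   direct product structure that the library puts on pairs. *)
Definition schreier_ext (K : umagmaType) (G : groupType)
  (D : schreier_data K G) : Type := (K * G)%type.

Section SchreierExtension.

Variables (K : umagmaType) (G : groupType) (D : schreier_data K G).

Definition schreier_mul (u v : schreier_ext D) : schreier_ext D :=
  (u.1 * v.1, cocycle D u.1 v.1 * twist D v.1 u.2 * v.2).

Definition schreier_one : schreier_ext D := (1, 1).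

Fact schreier_mul1 : left_id schreier_one schreier_mul.
Proof. by case=> tau t; rewrite /schreier_mul /= cocycle_1l morph_one !mul1g. Qed.

Fact schreier_mulr1 : right_id schreier_one schreier_mul.
Proof.
by case=> tau t; rewrite /schreier_mul /= cocycle_1r twist_1 mul1g !mulg1.
Qed.

HB.instance Definition _ := Choice.copy (schreier_ext D) (K * G)%type.
HB.instance Definition _ := hasMul.Build (schreier_ext D) schreier_mul.
HB.instance Definition _ := Magma_isUMagma.Build (schreier_ext D)
  schreier_mul1 schreier_mulr1.

Definition schreier_left_nuclear : Prop :=
  forall t : G, left_nucleus ((1, t) : schreier_ext D).

End SchreierExtension.

Definition inner (G : groupType) (s t : G) : G := s * t * s^-1.

Section InnerExtension.

Fact inner_mul (G : groupType) (s : G) : {morph inner s : t u / t * u}.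
Proof. by move=> t u; rewrite /inner !mulgA mulgVK. Qed.

HB.instance Definition _ (G : groupType) (s : G) :=
  isMultiplicative.Build G G (inner s) (inner_mul s).

Fact inner_bij (G : groupType) (s : G) : bijective (inner s).
Proof.
by exists (inner s^-1) => t; rewrite /inner !mulgA ?invgK ?mulgV ?mulVg mul1g
  -mulgA ?mulgV ?mulVg mulg1.
Qed.

Definition inner_aut (G : groupType) (s : G) : automorphism G :=
  @Automorphism G (inner s) (inner_bij s).

Variables (K G : groupType) (phi : {multiplicative K -> G}).

Fact inner_phi1 (t : G) : inner_aut (phi 1) t = t.
Proof. by rewrite /= /inner morph_one invg1 mulg1 mul1g. Qed.

Definition inner_schreier_data : schreier_data K G :=
  @SchreierData K G (fun _ _ => 1) (fun sigma => inner_aut (phi sigma))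
    (fun _ => erefl) (fun _ => erefl) inner_phi1.

End InnerExtension.

(* Main.v *)
(* (x y) z = x (y z) holds exactly when phi [~ z_1, y_1] commutes with x_2.
   The first component of x plays no role, so the inclusion of
   {1} x G in the left nucleus already forces full associativity. *)
Require Import Defs.
From mathcomp Require Import all_boot.

Local Open Scope group_scope.

Lemma morph_inv (K G : groupType) (f : {multiplicative K -> G}) (x : K) :
  f x^-1 = (f x)^-1.
Proof. by apply: (mulgI (f x)); rewrite -gmulfM !mulgV morph_one. Qed.

Lemma morph_commg (K G : groupType) (f : {multiplicative K -> G}) (x y : K) :
  f [~ x, y] = [~ f x, f y].
Proof. by rewrite /commg /conjg !gmulfM !morph_inv. Qed.

Lemma centre_subgroup (G : groupType) : is_subgroup (@centre G).
Proof.
split=> [x|x y cx cy z|x cx z]; first exact/commute_sym/commute1.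
  exact/commute_sym/commuteM/commute_sym/cy/commute_sym/cx.
exact/commute_sym/commuteV/commute_sym/cx.
Qed.

Lemma preim_subgroup (K G : groupType) (f : {multiplicative K -> G})
  (H : G -> Prop) : is_subgroup H -> is_subgroup (fun x => H (f x)).
Proof.
case=> H1 HM HV; split=> [|x y Hx Hy|x Hx]; first by rewrite morph_one.
  by rewrite gmulfM; apply: HM.
by rewrite morph_inv; apply: HV.
Qed.

(** The preimage of the centre under [phi] is a subgroup of [K], so it contains the generated
    subgroup [K'] as soon as it contains every commutator. *)
Lemma phi_commutator_central (K G : groupType) (phi : {multiplicative K -> G}) :
  (forall k, commutator_subgroup k -> centre (phi k)) <->
  (forall a b : K, centre (phi [~ a, b])).
Proof.
split=> [cK' a b | cab k K'k].
  by apply: cK' => H _; apply; exists a, b.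
apply: (K'k (fun x => centre (phi x))) => [|_ [a [b ->]]]; last exact: cab.
exact/preim_subgroup/centre_subgroup.
Qed.

(** Solving [x * r = 1] and [l * x = 1] gives one-sided inverses, which associativity identifies:
    [r = (l * x) * r = l * (x * r) = l]. *)
Lemma loop_inverses (L : umagmaType) :
  is_loop L -> associative (fun x y : L => x * y) ->
  forall x : L, exists y : L, x * y = 1 /\ y * x = 1.
Proof.
move=> loopL mulA x; have [[r [xr _]] [l [lx _]]] := loopL x 1.
have rl : r = l by rewrite -[r]mul1g -lx -[LHS]mulA /= xr mulg1.
by exists r; split=> //; rewrite rl.
Qed.

Section InnerSchreier.

Variables (K G : groupType) (phi : {multiplicative K -> G}).
Let E : umagmaType := schreier_ext (inner_schreier_data phi).

Lemma inner_schreier_mulE (x y : E) :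
  x * y = (x.1 * y.1, phi y.1 * x.2 * (phi y.1)^-1 * y.2) :> E.
Proof. by congr (_, _); rewrite /= mul1g. Qed.

Lemma inner_schreier_loop : is_loop E.
Proof.
move=> [s u] [t v]; split.
  (* The first component is forced to be [s^-1 * t]; this fixes the conjugation acting on [u], and
     the second component is then solved for in [G]. *)
  exists (s^-1 * t, (phi (s^-1 * t) * u * (phi (s^-1 * t))^-1)^-1 * v).
  split=> [|[k w]]; first by rewrite inner_schreier_mulE /= !mulVKg.
  by rewrite inner_schreier_mulE /= => -[<- <-]; rewrite !mulKg.
(* Here the unknown itself is conjugated, by the known element [phi s], so the conjugation is
   undone. *)
exists (t * s^-1, (phi s)^-1 * (v * u^-1) * phi s).
split=> [|[k w]]; last first.
  rewrite inner_schreier_mulE /= => -[<- <-].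
  by rewrite !mulgK !mulgA mulVg mul1g mulgVK.
by rewrite inner_schreier_mulE /= !mulgA mulgV mul1g mulgK !mulgVK.
Qed.

(** With [a = phi x.1] and [b = phi y.1], conjugating [z.2] by [phi] of the palindrome
    [x.1 * y.1 * x.1] ends in [a^-1 * b^-1 * a^-1]; its tail [b^-1 * a^-1] cancels the [a * b] that
    begins the second component of [(x * y) * x]. *)
Lemma inner_schreier_right_bol : right_bol_identity E.
Proof.
move=> x y z; rewrite !inner_schreier_mulE /= !gmulfM !invgM !mulgA.
by rewrite !mulgVK.
Qed.

Lemma inner_schreier_mulA_iff (x y z : E) :
  (x * y) * z = x * (y * z) <-> commute (phi [~ z.1, y.1]) x.2.
Proof.
rewrite morph_commg !inner_schreier_mulE /= gmulfM invgM [x.1 * (_ * _)]mulgA.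
move: (phi z.1) (phi y.1) x.2 y.2 => c b s t.
(* Both sides are brought to the form [b * c * _ * b^-1 * (t * c^-1 * z.2)] by means of [c * b = b *
   c * [~ c, b]] and [c^-1 * b^-1 * c = [~ c, b] * b^-1]; they differ only in the order of [s] and
   [[~ c, b]]. *)
have lhsE : c * (b * s * b^-1 * t) * c^-1 * z.2 =
    b * c * ([~ c, b] * s) * b^-1 * (t * c^-1 * z.2).
  by rewrite /commg /conjg !mulgA mulgK mulgV mul1g.
have rhsE : b * c * s * (c^-1 * b^-1) * (c * t * c^-1 * z.2) =
    b * c * (s * [~ c, b]) * b^-1 * (t * c^-1 * z.2).
  by rewrite /commg /conjg !mulgA mulgK.
split=> [[] | comm].
  by rewrite !(lhsE, rhsE) => /mulIg/mulIg/mulgI.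
by rewrite lhsE rhsE comm.
Qed.

End InnerSchreier.

Theorem proposition39 (K G : groupType) (phi : {multiplicative K -> G}) :
  let D := inner_schreier_data phi in
  is_right_bol_loop (schreier_ext D) /\
  (schreier_left_nuclear D <->
     (forall k : K, commutator_subgroup k -> centre (phi k))) /\
  ((forall k : K, commutator_subgroup k -> centre (phi k)) <->
     is_group (schreier_ext D)).
Proof.
move=> D; have loopE := @inner_schreier_loop K G phi.
split; first by split=> //; exact: inner_schreier_right_bol.
split; split.
- move=> nucl; apply/phi_commutator_central => a b t.
  (* This triple makes the criterion say that [phi [~ a, b]] commutes with [t]. *)
  by have /inner_schreier_mulA_iff := nucl t (b, 1) (a, 1).
- move=> cK' t x y; apply/inner_schreier_mulA_iff.
  by move/phi_commutator_central: cK'; apply.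
- move=> cK'; have mulA : associative (fun x y : schreier_ext D => x * y).
    move=> x y z; apply/esym/inner_schreier_mulA_iff.
    by move/phi_commutator_central: cK'; apply.
  by split=> //; apply: loop_inverses.
- case=> mulA _; apply/phi_commutator_central => a b t.
  (* The test triple is the same as for left nuclearity, since it starts in the copy of [G]. *)
  by have /inner_schreier_mulA_iff := esym (mulA (1, t) (b, 1) (a, 1)).
Qed.
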